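(* Let $\lambda>0$ and $\mu$ be real numbers. Let $\mathsf{Paw}$ be the graph on $4$ vertices obtained from the triangle $K_3$ by appending a leaf to one of its vertices. The multiset $\{0, \lambda,\lambda, \mu\}$ is Laplacian realizable for $\mathsf{Paw}$ if and only if $\mu \geq (2 + \sqrt{3})\lambda$ or $0 < \mu \leq (2 - \sqrt{3})\lambda$.
   Context: For a finite simple graph $G$ on $n$ vertices, $\mathcal{S}_L(G)$ denotes the set of $n\times n$ real symmetric matrices $A=[a_{i,j}]$ such that $a_{i,j}<0$ if $\{i,j\}\in E(G)$, $a_{i,j}=0$ if $i\neq j$ and $\{i,j\}\notin E(G)$, and $a_{i,i}=-\sum_{k\neq i}a_{i,k}$ for all $i$. A multiset of $n$ real numbers is Laplacian realizable for $G$ if it is the spectrum (multiset of eigenvalues) of some $A\in\mathcal{S}_L(G)$. *)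

(* Defs.v *)
From mathcomp Require Import all_boot all_order all_algebra.
Set Implicit Arguments.
Unset Strict Implicit.
Unset Printing Implicit Defensive.
Import GRing.Theory Num.Theory.
Local Open Scope ring_scope.

Record sgraph (n : nat) := SGraph {
  adj :> rel 'I_n;
  adj_sym : symmetric adj;
  adj_irrefl : irreflexive adj }.

Definition in_SL (R : rcfType) (n : nat) (G : sgraph n) (A : 'M[R]_n) : Prop :=
  [/\ A^T = A,
      forall i j, G i j -> A i j < 0,
      forall i j, i != j -> ~~ G i j -> A i j = 0
    & forall i, A i i = - \sum_(k < n | k != i) A i k].

(* Eigenvalues are counted with algebraic multiplicity; [s] represents a
   multiset, the product being invariant under permutation of [s]. *)
Definition is_spectrum (R : rcfType) (n : nat) (A : 'M[R]_n) (s : seq R) : Prop :=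
  char_poly A = \prod_(x <- s) ('X - x%:P).

Definition laplacian_realizable (R : rcfType) (n : nat) (G : sgraph n)
    (s : seq R) : Prop :=
  exists2 A : 'M[R]_n, in_SL G A & is_spectrum A s.

Definition paw_edges : seq (nat * nat) := [:: (0, 1); (0, 2); (1, 2); (2, 3)]%N.

Definition paw_rel : rel 'I_4 := fun i j =>
  ((val i, val j) \in paw_edges) || ((val j, val i) \in paw_edges).

Lemma paw_sym : symmetric paw_rel.
Proof. by move=> i j; rewrite /paw_rel orbC. Qed.

Lemma paw_irrefl : irreflexive paw_rel.
Proof. by case=> [[|[|[|[|]]]]]. Qed.

Definition Paw : sgraph 4 := SGraph paw_sym paw_irrefl.

(* Main.v *)
Require Import Defs.
From mathcomp Require Import all_boot all_order all_algebra.
From mathcomp Require Import ring lra.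
Set Implicit Arguments.
Unset Strict Implicit.
Unset Printing Implicit Defensive.
Import GRing.Theory Num.Theory.
Local Open Scope ring_scope.

(** A matrix of S_L(Paw) is the Laplacian of the Paw with positive weights
    a = w(01), b = w(02), c = w(12) on the triangle and d = w(23) on the pendant
    edge. Suppose that lambda is a double eigenvalue. By symmetry its eigenspace
    has dimension at least 2, so it contains a nonzero vector v with v_3 = 0;
    row 3 then forces v_2 = 0, row 2 makes v proportional to (c, -b, 0, 0), and
    rows 0 and 1 give b = c and lambda = 2 a + b ([double_root_weights]). The
    remaining eigenvectors are constant on {0, 1}, and the trace and the second
    symmetric function of the corresponding quotient matrix give
      lambda + mu = 3 b + 2 d   and   lambda mu = 4 b d.
    Eliminating d leaves 6 b^2 - 2 (lambda + mu) b + lambda mu = 0. Hence mu > 0,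
    and the discriminant condition mu^2 - 4 lambda mu + lambda^2 >= 0 says that
    mu / lambda lies outside the open interval (2 - sqrt 3, 2 + sqrt 3).
    Conversely, under that condition the smaller root b of the quadratic lies
    strictly between 0 and lambda, and a = (lambda - b) / 2,
    d = lambda mu / (4 b) are the other weights.

    The dimension count for the eigenspace is carried out with minors: a
    singular symmetric matrix M satisfies (tr adj M)^2 = |adj M|^2 in the
    Frobenius norm, so that over an ordered field a double root of the
    characteristic polynomial annihilates the whole adjugate
    ([bordered_minors_eq0]). *)

(** * The weighted Laplacian of the Paw *)

Definition paw_laplacian (R : rcfType) (a b c d : R) : 'M[R]_4 :=
  \matrix_(i, j) nth 0 (nth [::]
    [:: [:: a + b; - a; - b; 0];
        [:: - a; a + c; - c; 0];
        [:: - b; - c; b + c + d; - d];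
        [:: 0; 0; - d; d]] i) j.

Lemma in_SL_Paw (R : rcfType) (A : 'M[R]_4) :
  in_SL Paw A <->
  exists a b c d : R, [/\ 0 < a, 0 < b, 0 < c, 0 < d & A = paw_laplacian a b c d].
Proof.
pose o0 : 'I_4 := @Ordinal 4 0 isT; pose o1 : 'I_4 := @Ordinal 4 1 isT.
pose o2 : 'I_4 := @Ordinal 4 2 isT; pose o3 : 'I_4 := @Ordinal 4 3 isT.
have ordE (i : 'I_4) : [\/ i = o0, i = o1, i = o2 | i = o3].
  case: i => [[|[|[|[|//]]]] hi];
    [constructor 1|constructor 2|constructor 3|constructor 4]; exact: val_inj.
have sum4 (F : 'I_4 -> R) (i : 'I_4) : \sum_(k < 4 | k != i) F k =
    (if o0 != i then F o0 else 0) + (if o1 != i then F o1 else 0)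
    + (if o2 != i then F o2 else 0) + (if o3 != i then F o3 else 0).
  rewrite big_mkcond !big_ord_recl big_ord0 /= addr0 !addrA.
  by congr (_ + _ + _ + _); congr (if _ != i then F _ else 0); apply: val_inj.
split=> [[Asym Aneg A0 Adiag] | [a [b [c [d [ha hb hc hd ->]]]]]]; last first.
  split.
  - by apply/matrixP=> i j; case: (ordE i) => ->; case: (ordE j) => ->;
      rewrite !mxE.
  - by move=> i j; case: (ordE i) => ->; case: (ordE j) => -> //= _;
      rewrite !mxE /= oppr_lt0.
  - by move=> i j; case: (ordE i) => ->; case: (ordE j) => -> //= _ _;
      rewrite !mxE.
  - by move=> i; rewrite sum4; case: (ordE i) => ->; rewrite /= !mxE /=; ring.
have symA i j : A i j = A j i by rewrite -{1}Asym mxE.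
have z03 : A o0 o3 = 0 by apply: A0.
have z13 : A o1 o3 = 0 by apply: A0.
exists (- A o0 o1), (- A o0 o2), (- A o1 o2), (- A o2 o3).
split; rewrite ?oppr_gt0; try exact: Aneg.
apply/matrixP=> i j; case: (ordE i) => ->; case: (ordE j) => ->;
  rewrite mxE /= ?opprK ?z03 ?z13 // ?Adiag ?sum4 /=
    ?(symA o1 o0) ?(symA o2 o0) ?(symA o2 o1) ?(symA o3 o2)
    ?(symA o3 o0) ?(symA o3 o1) ?z03 ?z13 //; ring.
Qed.

(** Indexing the entries by nat lets the repeated row expansion of a concrete
    determinant act on the indices alone. *)
Definition nat_det (S : comNzRingType) (n : nat) (f : nat -> nat -> S) : S :=
  \det (\matrix_(i < n, j < n) f i j).

Lemma nat_det_recl (S : comNzRingType) (n : nat) (f : nat -> nat -> S) :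
  nat_det n.+1 f = \sum_(k < n.+1)
    (-1) ^+ k * f 0 k * nat_det n (fun i j => f i.+1 (bump k j)).
Proof.
rewrite /nat_det (expand_det_row _ ord0); apply: eq_bigr => k _.
rewrite mxE /cofactor add0n mulrA [_ * f _ _]mulrC; congr (_ * \det _).
by apply/matrixP=> i j; rewrite !mxE.
Qed.

(** The coefficients are the weighted counts of rooted spanning forests. *)
Lemma char_poly_paw (R : rcfType) (a b c d : R) :
  char_poly (paw_laplacian a b c d) =
  'X * ('X^3 - (2 * (a + b + c + d))%:P * 'X^2
        + (3 * (a * b + a * c + b * c + b * d + c * d) + 4 * (a * d))%:P * 'X
        - (4 * d * (a * b + a * c + b * c))%:P).
Proof.
pose L i j := nth 0 (nth [::]
    [:: [:: a + b; - a; - b; 0];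
        [:: - a; a + c; - c; 0];
        [:: - b; - c; b + c + d; - d];
        [:: 0; 0; - d; d]] i) j.
have -> : char_poly (paw_laplacian a b c d)
    = nat_det 4 (fun i j => 'X *+ (i == j) - (L i j)%:P).
  by congr (\det _); apply/matrixP=> i j; rewrite !mxE.
rewrite !(nat_det_recl, big_ord_recl, big_ord0).
rewrite /nat_det !det_mx00 /bump /L /=.
ring.
Qed.

Lemma is_spectrum_paw (R : rcfType) (a b c d lambda mu : R) :
  is_spectrum (paw_laplacian a b c d) [:: 0; lambda; lambda; mu] <->
  [/\ 2 * (a + b + c + d) = 2 * lambda + mu,
      3 * (a * b + a * c + b * c + b * d + c * d) + 4 * (a * d)
        = lambda ^+ 2 + 2 * lambda * mu
    & 4 * d * (a * b + a * c + b * c) = lambda ^+ 2 * mu].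
Proof.
rewrite /is_spectrum char_poly_paw !big_cons big_nil.
set e1 := 2 * _; set e2 := _ + 4 * _; set e3 := 4 * d * _.
have -> : ('X - 0%:P) * (('X - lambda%:P) * (('X - lambda%:P) *
    (('X - mu%:P) * 1))) = 'X * ('X^3 - (2 * lambda + mu)%:P * 'X^2
    + (lambda ^+ 2 + 2 * lambda * mu)%:P * 'X - (lambda ^+ 2 * mu)%:P).
  by ring.
have X0 : 'X != 0 :> {poly R} by rewrite polyX_eq0.
split=> [/(mulfI X0) E | [-> -> ->] //].
have coefE i := congr1 (fun p : {poly R} => p`_i) E.
move: (coefE 0%N) (coefE 1%N) (coefE 2%N).
rewrite !(coefB, coefD, coefCM, coefXn, coefX, coefC) /=.
rewrite !(mulr0, mulr1, oppr0, subr0, sub0r, addr0, add0r).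
by move=> /oppr_inj e3E e2E /oppr_inj e1E.
Qed.

(** * A double eigenvalue determines the weights *)

(** The minors below are those of the symmetric matrix
      [  P -a -b  0 ]
      [ -a  Q -c  0 ]
      [ -b -c  T -d ]
      [  0  0 -d  D ],
    whose determinant and adjugate trace are assumed to vanish. By Jacobi's
    identity on 2 x 2 minors of the adjugate, m_ii m_jj - m_ij^2 is a multiple
    of the determinant, so the squares of all the entries of the adjugate add
    up to the square of its trace. *)
Lemma bordered_minors_eq0 (R : realFieldType) (a b c d P Q T D : R) :
  let m33 := P * Q * T - 2 * a * b * c - P * c ^+ 2 - Q * b ^+ 2 - T * a ^+ 2 in
  let m22 := D * (P * Q - a ^+ 2) in
  let m11 := P * (T * D - d ^+ 2) - b ^+ 2 * D in
  let m00 := Q * (T * D - d ^+ 2) - c ^+ 2 * D in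
  D * m33 - d ^+ 2 * (P * Q - a ^+ 2) = 0 ->
  m00 + m11 + m22 + m33 = 0 ->
  d * (P * c + a * b) = 0 /\ d * (Q * b + a * c) = 0.
Proof.
move=> m33 m22 m11 m00 det0 tr0.
pose m13 := d * (P * c + a * b); pose m03 := d * (Q * b + a * c).
pose m23 := d * (P * Q - a ^+ 2).
pose m12 := D * (P * c + a * b); pose m02 := D * (Q * b + a * c).
pose m01 := a * (T * D - d ^+ 2) + b * c * D.
pose S := P * Q - a ^+ 2 + (P * T - b ^+ 2) + P * D + (Q * T - c ^+ 2)
          + Q * D + (T * D - d ^+ 2).
have frobenius : m00 ^+ 2 + m11 ^+ 2 + m22 ^+ 2 + m33 ^+ 2
    + 2 * (m01 ^+ 2 + m02 ^+ 2 + m03 ^+ 2 + m12 ^+ 2 + m13 ^+ 2 + m23 ^+ 2) = 0.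
  transitivity ((m00 + m11 + m22 + m33) ^+ 2
      - 2 * (D * m33 - d ^+ 2 * (P * Q - a ^+ 2)) * S).
    by rewrite /m00 /m11 /m22 /m33 /m01 /m02 /m03 /m12 /m13 /m23 /S; ring.
  by rewrite det0 tr0; ring.
have sq := @sqr_ge0 R.
move: (sq m00) (sq m11) (sq m22) (sq m33) (sq m01) (sq m02) (sq m03)
  (sq m12) (sq m13) (sq m23) => h00 h11 h22 h33 h01 h02 h03 h12 h13 h23.
by split; apply/eqP; rewrite -sqrf_eq0; apply/eqP;
  [rewrite -/m13 | rewrite -/m03]; lra.
Qed.

(** With M the Laplacian minus lambda and q the characteristic polynomial
    divided by 'X, det M = lambda q(lambda) and
    tr (adj M) = - (q(lambda) + lambda q'(lambda)); both vanish since lambda is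
    a double root of q. The minors m_13 and m_03 are the ones that express the
    existence of an eigenvector supported on {0, 1}. *)
Lemma double_root_weights (R : realFieldType) (a b c d lambda mu : R) :
  0 < b -> 0 < c -> 0 < d -> lambda != 0 ->
  2 * (a + b + c + d) = 2 * lambda + mu ->
  3 * (a * b + a * c + b * c + b * d + c * d) + 4 * (a * d)
    = lambda ^+ 2 + 2 * lambda * mu ->
  4 * d * (a * b + a * c + b * c) = lambda ^+ 2 * mu ->
  b = c /\ lambda = 2 * a + b.
Proof.
move=> hb hc hd hl E1 E2 E3.
pose q x := x ^+ 3 - 2 * (a + b + c + d) * x ^+ 2
  + (3 * (a * b + a * c + b * c + b * d + c * d) + 4 * (a * d)) * x
  - 4 * d * (a * b + a * c + b * c).
pose q' x := 3 * x ^+ 2 - 4 * (a + b + c + d) * x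
  + (3 * (a * b + a * c + b * c + b * d + c * d) + 4 * (a * d)).
have q0 : q lambda = 0 by rewrite /q E1 E2 E3; ring.
have q'0 : q' lambda = 0.
  transitivity (3 * lambda ^+ 2 - 2 * (2 * (a + b + c + d)) * lambda
      + (lambda ^+ 2 + 2 * lambda * mu)); first by rewrite /q' E2; ring.
  by rewrite E1; ring.
have [||m13 m03] := @bordered_minors_eq0 R a b c d
  (a + b - lambda) (a + c - lambda) (b + c + d - lambda) (d - lambda).
- by transitivity (lambda * q lambda); [rewrite /q; ring | rewrite q0 mulr0].
- transitivity (- (q lambda + lambda * q' lambda)); first by rewrite /q /q'; ring.
  by rewrite q0 q'0; ring.
have dn0 := lt0r_neq0 hd.
move/eqP: m13; rewrite mulf_eq0 (negPf dn0) /= => /eqP m13.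
move/eqP: m03; rewrite mulf_eq0 (negPf dn0) /= => /eqP m03.
(* Both equations read a b + a c + b c = lambda c = lambda b. *)
have bc : b = c by apply: (mulfI hl); lra.
split=> //; apply: (mulIf (lt0r_neq0 hb)); rewrite -bc in m13; lra.
Qed.

(** * The admissible range of mu *)

Lemma outside_sqrt3_range (R : rcfType) (lambda mu : R) :
  0 < lambda ->
  (0 < mu /\ 0 <= mu ^+ 2 - 4 * lambda * mu + lambda ^+ 2) <->
  (2 + Num.sqrt 3) * lambda <= mu \/ 0 < mu <= (2 - Num.sqrt 3) * lambda.
Proof.
move=> hl; set r := Num.sqrt 3.
have r2 : r ^+ 2 = 3 by rewrite sqr_sqrtr.
have r0 : 0 < r by rewrite sqrtr_gt0.
have -> : mu ^+ 2 - 4 * lambda * mu + lambda ^+ 2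
    = (mu - (2 + r) * lambda) * (mu - (2 - r) * lambda).
  transitivity (mu ^+ 2 - 4 * lambda * mu + (4 - r ^+ 2) * lambda ^+ 2).
    by rewrite r2; ring.
  by ring.
have rl : 0 < r * lambda by exact: mulr_gt0.
split=> [[hm h] | [h | /andP[hm h]]].
- case: (lerP ((2 + r) * lambda) mu) => h1; [by left | right].
  rewrite hm /=; case: (lerP mu ((2 - r) * lambda)) => // h2.
  have : (mu - (2 + r) * lambda) * (mu - (2 - r) * lambda) < 0.
    by rewrite nmulr_rlt0 ?subr_lt0 ?subr_gt0.
  by lra.
- split; first by lra.
  by apply: mulr_ge0; lra.
- by split=> //; apply: mulr_le0; lra.
Qed.

(** The quadratic for b is that of the header comment; its smaller root is
    below lambda because the discriminant exceeds (mu - 5 lambda)^2 as soon as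
    mu > 4 lambda. *)
Lemma weights_of_discriminant (R : rcfType) (lambda mu : R) :
  0 < lambda -> 0 < mu -> 0 <= mu ^+ 2 - 4 * lambda * mu + lambda ^+ 2 ->
  exists b d, [/\ 0 < b < lambda, 0 < d, lambda + mu = 3 * b + 2 * d
                & lambda * mu = 4 * b * d].
Proof.
move=> hl hm hD; set s := Num.sqrt (mu ^+ 2 - 4 * lambda * mu + lambda ^+ 2).
have s2 : s ^+ 2 = mu ^+ 2 - 4 * lambda * mu + lambda ^+ 2 by rewrite sqr_sqrtr.
have s0 : 0 <= s by exact: sqrtr_ge0.
have lm : 0 < lambda * mu by exact: mulr_gt0.
have s_lt : s < lambda + mu.
  by rewrite -(@ltr_pXn2r _ 2) ?nnegrE //; [rewrite s2; lra | lra].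
have s_gt : mu - 5 * lambda < s.
  case: (ltrP mu (5 * lambda)) => h; first by lra.
  have : 4 * lambda * lambda < mu * lambda by rewrite ltr_pM2r //; lra.
  move=> h4; rewrite -(@ltr_pXn2r _ 2) ?nnegrE //; last lra.
  by rewrite s2; lra.
exists ((lambda + mu - s) / 6), ((lambda + mu + s) / 4).
split; [apply/andP; split; lra | lra | lra |].
transitivity (((lambda + mu) ^+ 2 - s ^+ 2) / 6); last by field.
by rewrite s2; field.
Qed.

Theorem theorem3p13 (R : rcfType) (lambda mu : R) (hlambda : 0 < lambda) :
  laplacian_realizable Paw [:: 0; lambda; lambda; mu] <->
  (2 + Num.sqrt 3) * lambda <= mu \/ 0 < mu <= (2 - Num.sqrt 3) * lambda.
Proof.
split=> [[A /in_SL_Paw[a [b [c [d [ha hb hc hd ->]]]]] /is_spectrum_paw] | ].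
- case=> E1 E2 E3; apply/outside_sqrt3_range => //.
  have [bc lE] := double_root_weights hb hc hd (lt0r_neq0 hlambda) E1 E2 E3.
  subst c.
  have muE : mu = 3 * b + 2 * d - lambda by lra.
  have lmE : lambda * mu = 4 * b * d.
    apply: (mulfI (lt0r_neq0 hlambda)); rewrite mulrA -expr2 -E3 lE; ring.
  split.
    by rewrite -(pmulr_rgt0 _ hlambda) lmE !mulr_gt0.
  (* A quarter of the discriminant is the square of half the derivative of the
     quadratic at its root b. *)
  rewrite (_ : _ + _ = (3 * b - 2 * d) ^+ 2) ?sqr_ge0 //.
  transitivity ((lambda + mu) ^+ 2 - 6 * (lambda * mu)); first by ring.
  by rewrite lmE muE; ring.
- move=> /(outside_sqrt3_range _ hlambda)[hm hD].
  have [b [d [/andP[hb bl] hd Es Ep]]] := weights_of_discriminant hlambda hm hD.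
  pose a := (lambda - b) / 2.
  have lE : lambda = 2 * a + b by rewrite /a; field.
  have ha : 0 < a by rewrite /a; lra.
  clearbody a.
  exists (paw_laplacian a b b d).
    by apply/in_SL_Paw; exists a, b, b, d; split.
  have muE : mu = 3 * b + 2 * d - lambda by lra.
  apply/is_spectrum_paw; split.
  + by lra.
  + transitivity (lambda ^+ 2 + 2 * (lambda * mu)); last by ring.
    rewrite Ep (_ : 2 * _ = lambda * mu + 4 * b * d); last by rewrite Ep; ring.
    by rewrite muE lE; ring.
  + transitivity (lambda * (lambda * mu)); last by ring.
    by rewrite Ep lE; ring.
Qed.
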